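(* Let $\mathbb{H}$ be a hypergraph on $[n]$. For any acyclic orientations $A$ and $B$ of $\mathbb{H}$, one has $A\le B$ in the hypergraphic poset $P_{\mathbb{H}}$ if and only if $A(H)\le B(H)$ for all $H\in\mathbb{H}$.
   Context: Fix an integer $n\ge 1$ and write $[n]=\{1,\dots,n\}$. A hypergraph $\mathbb{H}$ on $[n]$ is a set of subsets of $[n]$; by convention all singletons $\{i\}$, $i\in[n]$, belong to $\mathbb{H}$. Elements of $\mathbb{H}$ are called hyperedges. An orientation of $\mathbb{H}$ is a map $A:\mathbb{H}\to[n]$ with $A(H)\in H$ for all $H\in\mathbb{H}$. The orientation $A$ is acyclic if there are no hyperedges $H_1,\dots,H_k\in\mathbb{H}$ with $k\ge 2$ such that $A(H_{r+1})\in H_r\setminus\{A(H_r)\}$ for $r\in[k-1]$ and $A(H_1)\in H_k\setminus\{A(H_k)\}$. Two orientations $A\ne B$ of $\mathbb{H}$ are related by an increasing flip (from $A$ to $B$) if there exist $1\le i<j\le n$ such that for all $H\in\mathbb{H}$: (i) if $A(H)\ne B(H)$ then $A(H)=i$ and $B(H)=j$; and (ii) if $\{i,j\}\subseteq H$, then $A(H)=i\iff B(H)=j$. The increasing flip graph is the directed graph whose vertices are the acyclic orientations of $\mathbb{H}$, with an arc from $A$ to $B$ whenever $A$ and $B$ are related by an increasing flip from $A$ to $B$. The hypergraphic poset $P_{\mathbb{H}}$ is the (reflexive) transitive closure of this graph: $A\le B$ if and only if there is a directed path, possibly of length $0$, from $A$ to $B$ in the increasing flip graph. *)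

(* Defs.v *)
From Stdlib Require Import Relations.
From mathcomp Require Import all_boot.

Set Implicit Arguments.
Unset Strict Implicit.
Unset Printing Implicit Defensive.

(* [n] is represented by 'I_n: labels are shifted to 0..n-1, and only their
   order matters. *)
Definition hypergraph (n : nat) (HH : {set {set 'I_n}}) : Prop :=
  forall i : 'I_n, [set i] \in HH.

(* Maps are defined on the hyperedges only, so that their Leibniz equality is
   equality of maps HH -> [n], without values outside HH. *)
Definition hyperedge (n : nat) (HH : {set {set 'I_n}}) : finType :=
  {H : {set 'I_n} | H \in HH}.

Definition hmap (n : nat) (HH : {set {set 'I_n}}) : finType :=
  {ffun hyperedge HH -> 'I_n}.

Definition orientation (n : nat) (HH : {set {set 'I_n}}) (A : hmap HH) : Prop :=
  forall H : hyperedge HH, A H \in val H.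

(* For s = [:: H_1; ...; H_k], [cycle] asserts the relation between H_r and
   H_(r+1) for r < k, and between H_k and H_1. *)
Definition acyclic (n : nat) (HH : {set {set 'I_n}}) (A : hmap HH) : Prop :=
  ~ exists s : seq (hyperedge HH),
      2 <= size s /\ cycle (fun H H' => A H' \in val H :\ A H) s.

Definition acyclic_orientation (n : nat) (HH : {set {set 'I_n}})
    (A : hmap HH) : Prop :=
  orientation A /\ acyclic A.

Definition increasing_flip (n : nat) (HH : {set {set 'I_n}})
    (A B : hmap HH) : Prop :=
  A <> B /\
  exists i j : 'I_n, i < j /\
    forall H : hyperedge HH,
      (A H <> B H -> A H = i /\ B H = j) /\
      ([set i; j] \subset val H -> (A H = i <-> B H = j)).

Definition flip_arc (n : nat) (HH : {set {set 'I_n}}) (A B : hmap HH) : Prop :=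
  [/\ acyclic_orientation A, acyclic_orientation B & increasing_flip A B].

(* The poset lives on acyclic orientations: on other maps this relation is just
   equality. *)
Definition hypergraphic_le (n : nat) (HH : {set {set 'I_n}}) :
    hmap HH -> hmap HH -> Prop :=
  clos_refl_trans (hmap HH) (@flip_arc n HH).

(* Main.v *)
(** Write [u ~> v] in [A] when some hyperedge [H] has [A H = u] and [v] in
    [H :\ u].  If [A <> B] are acyclic, choose among the hyperedges on which they
    differ one whose source [a = A H] is lowest for the order generated by [A];
    then, among those with [A H = a <> B H], choose one whose [c = B H] is highest
    for the order generated by [B].  Below [a] the orientations agree, so a longer
    path from [a] to [c] in [A] would be a path in [B], against the choice of [c].
    Hence [a ~> c] is a cover relation and flipping [a] to [c] in [A] preserves
    acyclicity.  The choice of [c] also forces [B H = c] on every flipped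
    hyperedge, so the flip brings [A] closer to [B].  When [A <= B] pointwise,
    [a < c], so the flip is increasing and stays below [B]. *)

Require Import Defs.
From Stdlib Require Import Relations.
From mathcomp Require Import all_boot zify.

Set Implicit Arguments.
Unset Strict Implicit.
Unset Printing Implicit Defensive.

Section AcyclicRelations.

Variable T : finType.
Implicit Types (e : rel T) (u v w : T).

(** Loops are excluded too, since [connect] is reflexive. *)
Definition acyclic_rel e := forall u v, e u v -> ~~ connect e v u.

(** Arcs point downwards, so lowest and highest elements can be chosen by minimising or maximising
    this number. *)
Definition height e u := #|connect e u|.

Lemma acyclic_rel_antisym e u v :
  acyclic_rel e -> connect e u v -> connect e v u -> u = v.
Proof.
move=> eA /connectP[[|w p] /= ep ->] // cvu.
case/andP: ep => euw ep; case/negP: (eA _ _ euw).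
by apply: connect_trans cvu; apply/connectP; exists p.
Qed.

Lemma height_lt e u v :
  acyclic_rel e -> connect e u v -> u != v -> height e v < height e u.
Proof.
move=> eA cuv nuv; apply: proper_card; apply/properP; split.
  by apply/subsetP => w; apply: connect_trans cuv.
exists u; rewrite ?inE; first exact: connect0.
by apply: contraNN nuv => cvu; rewrite (acyclic_rel_antisym eA cuv cvu).
Qed.

Lemma ranked_acyclic_rel e (f : T -> nat) :
  (forall u v, e u v -> f v < f u) -> acyclic_rel e.
Proof.
move=> ef u v /ef fvu; apply/negP => /connectP[p ep def_u].
suff: f (last v p) <= f v by rewrite -def_u leqNgt fvu.
elim: p v ep {fvu def_u} => //= w p IHp v /andP[/ef/ltnW fwv /IHp fw].
exact: leq_trans fwv.
Qed.

(* [below] is the preorder obtained by identifying [a] with [c]; as [c] is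
   covered by [a], it identifies nothing else. *)
Lemma acyclic_rel_flip e e' a c :
    acyclic_rel e -> e a c ->
    (forall x, e a x -> connect e x c -> x = c) ->
    (forall u v, e' u v ->
       [/\ u != v, (u, v) != (a, c) & e u v \/ u = c /\ connect e a v]) ->
  acyclic_rel e'.
Proof.
move=> eA eac cover e'P.
pose below u v := connect e u v || connect e u c && connect e a v.
have cac : connect e a c by apply: connect1.
have below_trans u v w : below u v -> below v w -> below u w.
  case/orP=> [cuv|/andP[cuc cav]] /orP[cvw|/andP[cvc caw]]; apply/orP.
  - by left; apply: connect_trans cvw.
  - by right; rewrite caw (connect_trans cuv).
  - by right; rewrite cuc (connect_trans cav).
  - by right; rewrite cuc.
have between u : connect e a u -> connect e u c -> u = a \/ u = c.
  case/connectP=> [[|x p] /= ep ->]; first by left.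
  case/andP: ep => eax ep clc; right.
  have cxl : connect e x (last x p) by apply/connectP; exists p.
  have xc := cover _ eax (connect_trans cxl clc).
  by apply: (acyclic_rel_antisym eA clc); rewrite -{1}xc.
have below_kernel u v : below u v -> below v u -> u != v ->
    (u = a \/ u = c) /\ (v = a \/ v = c).
  case/orP=> [cuv|/andP[cuc cav]] /orP[cvu|/andP[cvc cau]] nuv.
  - by rewrite (acyclic_rel_antisym eA cuv cvu) eqxx in nuv.
  - by split; apply: between => //; [apply: connect_trans cvc|
      apply: connect_trans cuv].
  - by split; apply: between => //; [apply: connect_trans cvu|
      apply: connect_trans cuc].
  - by split; apply: between.
(* Only [a] and [c] can tie, and between them [e'] allows only the arc from [c] to [a]. The extra
   unit at [c] breaks this tie; doubling keeps it from outweighing a strict inclusion. *)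
apply: (@ranked_acyclic_rel _ (fun u => #|below u|.*2 + (u == c))) => u v euv.
have [nuv nac huv] := e'P _ _ euv.
have buv : below u v.
  by case: huv => [/connect1 cuv|[-> cav]]; rewrite /below ?cuv // connect0 cav orbT.
have sub_uv : below v \subset below u.
  by apply/subsetP => w; apply: below_trans buv.
case bvu: (below v u).
  have [[uE|uE] [vE|vE]] := below_kernel _ _ buv bvu nuv;
    rewrite uE vE ?eqxx // in nuv nac *.
  rewrite eq_sym (negPf nuv) addn0 addn1 ltnS leq_double -uE -vE.
  exact: subset_leq_card.
have: #|below v| < #|below u|.
  apply: proper_card; apply/properP; split=> //; exists u.
    by rewrite unfold_in /below connect0.
  by rewrite unfold_in -/(below v u) bvu.
by case: (u == c) (v == c) => [] []; lia.
Qed.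

End AcyclicRelations.

Section Flips.

Variables (n : nat) (HH : {set {set 'I_n}}).
Implicit Types (A B : hmap HH) (H K : hyperedge HH).

Definition source_rel A : rel 'I_n :=
  fun u v => [exists H : hyperedge HH, (A H == u) && (v \in val H :\ u)].

Lemma source_relP A u v :
  reflect (exists H, [/\ A H = u, v \in val H & v != u]) (source_rel A u v).
Proof.
apply: (iffP existsP) => [[H /andP[/eqP <-]]|[H [<- vH vu]]].
  by rewrite in_setD1 => /andP[vu vH]; exists H.
by exists H; rewrite eqxx in_setD1 vu.
Qed.

Lemma source_relI A H v : v \in val H -> v != A H -> source_rel A (A H) v.
Proof. by move=> vH vA; apply/source_relP; exists H. Qed.

(** The end [K] is prescribed so that the lifted sequence of hyperedges can be closed into a
    cycle. *)
Lemma source_path A u p K :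
    path (source_rel A) u p -> A K = last u p ->
  exists H s, [/\ A H = u, last H s = K &
                  path (fun H H' => A H' \in val H :\ A H) H s].
Proof.
elim: p u => [|v p IHp] u /=; first by exists K, [::].
case/andP=> /existsP[H /andP[/eqP <- vH]] pp lK.
have [H' [s [AH' ls ps]]] := IHp _ pp lK.
by exists H, (H' :: s); rewrite /= AH' vH.
Qed.

Lemma acyclicP A : acyclic A <-> acyclic_rel (source_rel A).
Proof.
split=> [acA u v euv | acA [[|H s] [//]] /= s_gt0].
  apply/negP => /connectP[p ep def_u].
  have: path (source_rel A) u (v :: p) by rewrite /= euv.
  (* The arc that closes the walk at [u] supplies [K]; the rest is lifted so as to end there. *)
  rewrite lastI rcons_path => /andP[pp /source_relP[K [AK lK lNK]]].
  have [H [t [AH lt pt]]] := source_path pp AK.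
  have eKH : A H \in val K :\ A K.
    by rewrite -def_u in lK lNK; rewrite in_setD1 AH AK lNK.
  apply: acA; exists (H :: t); split; last by rewrite /= rcons_path pt lt.
  by case: t lt {pt} => //= HK; rewrite -HK in_setD1 eqxx in eKH.
case: s s_gt0 => // K s _ /andP[eHK].
have eS x t : path (fun H H' => A H' \in val H :\ A H) x t ->
    path (source_rel A) (A x) (map A t).
  elim: t x => //= y t IHt x; rewrite in_setD1 => /andP[/andP[yx yX] /IHt ->].
  by rewrite source_relI.
move/eS => pK; move: eHK; rewrite in_setD1 => /andP[KH HK].
case/negP: (acA _ _ (source_relI HK KH)); apply/connectP.
by exists [seq A i | i <- rcons s H]; rewrite // last_map last_rcons.
Qed.

(** Between orientations this is the only candidate: condition (ii) of a flip moves all these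
    hyperedges, and (i) moves no other. *)
Definition flip A (a c : 'I_n) : hmap HH :=
  [ffun H => if (A H == a) && (c \in val H) then c else A H].

(** A new arc goes from [c] to some [v] in a hyperedge of source [a], so [a] already reaches [v] in
    [A]; the arc from [a] to [c] disappears. *)
Lemma flip_acyclic_orientation A a c :
    acyclic_orientation A -> source_rel A a c ->
    (forall x, source_rel A a x -> connect (source_rel A) x c -> x = c) ->
  acyclic_orientation (flip A a c).
Proof.
move=> [oA /acyclicP acA] eac cover; split=> [H|].
  by rewrite ffunE; case: ifP => [/andP[]|].
apply/acyclicP/(acyclic_rel_flip acA eac cover) => u v.
case/source_relP=> H []; rewrite ffunE; case: ifP => [/andP[/eqP AH cH] <- vH|].
  move=> nvc; rewrite eq_sym nvc; split=> //.
    apply: contraNneq nvc => -[ca ->].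
    by rewrite ca.
  right; split=> //.
  by case: (eqVneq v a) => [->|nva]; [apply: connect0|
    apply/connect1/source_relP; exists H].
move=> nflip AH vH nvu; rewrite eq_sym nvu; split=> //.
  by apply/eqP => -[uE vE]; rewrite AH uE -vE eqxx vH in nflip.
by left; apply/source_relP; exists H.
Qed.

(** The third conclusion serves condition (ii) of a flip; the fourth makes the flip agree with [B]
    wherever it changes [A]. *)
Lemma exists_flip_toward A B :
    acyclic_orientation A -> acyclic_orientation B -> A <> B ->
  exists H0, let A' := flip A (A H0) (B H0) in
    [/\ A H0 != B H0, acyclic_orientation A', ~~ source_rel A (B H0) (A H0) &
        forall H, A H = A H0 -> B H0 \in val H -> B H = B H0].
Proof.
move=> hA hB neqAB; have [oA /acyclicP acA] := hA; have [oB /acyclicP acB] := hB.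
have /existsP[K0 dK0] : [exists H, A H != B H].
  apply/existsPn => eqAB; apply: neqAB; apply/ffunP => H.
  by apply/eqP; rewrite -[_ == _]negbK eqAB.
case: (@arg_minnP _ K0 (fun H => A H != B H)
  (fun H => height (source_rel A) (A H)) dK0) => K1 dK1 minK1.
case: (@arg_maxnP _ K1 (fun H => (A H == A K1) && (A H != B H))
  (fun H => height (source_rel B) (B H))); first by rewrite eqxx.
move=> H0 /andP[/eqP AH0 dH0] maxH0.
exists H0; set a := A H0 in AH0 dH0 *; set c := B H0 in dH0 maxH0 *.
have top H : A H = a -> B H != a -> connect (source_rel B) (B H) c -> B H = c.
  move=> AH BH cBH; apply: contraTeq isT => nBH.
  have := maxH0 H; rewrite -AH0 AH eqxx eq_sym BH => /(_ isT).
  by rewrite /= leqNgt (height_lt acB cBH nBH).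
have low H : connect (source_rel A) a (A H) -> A H != a -> A H = B H.
  move=> cAH nAH; apply: contraTeq isT => dH.
  have := minK1 _ dH.
  by rewrite -AH0 leqNgt (height_lt acA cAH) // eq_sym.
have eca : source_rel B c a by apply: source_relI; rewrite ?oA.
have eac : source_rel A a c by apply: source_relI; rewrite ?oB // eq_sym.
split=> //.
- apply: flip_acyclic_orientation => // x eax cxc.
  have {}cxc : connect (source_rel B) x c.
    (* By acyclicity a path of [A] from [x] never returns to [a], so by [low] the orientations agree
       on its hyperedges. *)
    have lift p : forall y, connect (source_rel A) x y -> path (source_rel A) y p ->
        connect (source_rel B) y (last y p).
      elim: p => [|z p IHp] y cxy /=; first by rewrite connect0.
      case/andP=> eyz pp; apply: connect_trans (IHp _ _ pp); last first.
        exact: connect_trans (connect1 eyz).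
      case/source_relP: eyz => H [AH zH nzy]; apply: connect1.
      have nya : y != a by apply: contraTneq cxy => ->; apply: acA.
      have BH : A H = B H.
        by apply: low; rewrite AH // (connect_trans (connect1 eax)).
      by rewrite -AH BH source_relI // -BH AH.
    case/connectP: cxc => p pp ->; apply: lift pp; exact: connect0.
  (* In [B], the label [B H] reaches [c] through [x]. It is not [a], as [c ~> a] in [B]; hence it is
     [c] by [top], and antisymmetry gives [x = c]. *)
  case/source_relP: (eax) => H [AH xH nxa].
  have cBx : connect (source_rel B) (B H) x.
    by case: (eqVneq x (B H)) => [->|nx]; [apply: connect0|
      apply/connect1/source_relI].
  have cBc := connect_trans cBx cxc.
  case: (eqVneq (B H) a) => [BHa|nBHa].
    by case/negP: (acB _ _ eca); rewrite -BHa.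
  rewrite (top _ AH nBHa cBc) in cBx.
  exact: acyclic_rel_antisym acB cxc cBx.
- by apply/negP => /connect1; apply/negP/acA.
move=> H AH cH.
have cBc : connect (source_rel B) (B H) c.
  by case: (eqVneq c (B H)) => [->|nc]; [apply: connect0|
    apply/connect1/source_relI].
apply: top => //; apply: contraTneq cBc => ->; exact: acB.
Qed.

Lemma hypergraphic_le_pointwise A B H : hypergraphic_le A B -> A H <= B H.
Proof.
elim=> [{}A {}B [_ _ [_ [i [j [ltij hij]]]]]|//|{}A C {}B _ leAC _ leCB].
  case: (eqVneq (A H) (B H)) => [->//|/eqP/(proj1 (hij H))[-> ->]].
  exact: ltnW.
exact: leq_trans leCB.
Qed.

(** Induction on the number of hyperedges where [A] and [B] differ: the flip takes the value of [A]
    or of [B] everywhere, and that of [B] at [H0]. *)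
Lemma pointwise_hypergraphic_le A B :
    acyclic_orientation A -> acyclic_orientation B ->
  (forall H, A H <= B H) -> hypergraphic_le A B.
Proof.
have [m] := ubnP #|[pred H | A H != B H]|.
elim: m A => // m IHm A; rewrite ltnS => lem hA hB leAB.
case: (eqVneq A B) => [->|/eqP neqAB]; first exact: rt_refl.
have [H0 [dH0 hA' nca toB]] := exists_flip_toward hA hB neqAB.
set A' := flip A _ _ in hA'.
have [oA _] := hA; have [oB _] := hB.
have A'H0 : A' H0 = B H0 by rewrite ffunE eqxx oB.
have A'E H : A' H = A H \/ A' H = B H.
  by rewrite ffunE; case: ifP => [/andP[/eqP AH cH]|]; [right; rewrite toB|left].
apply: (@rt_trans _ _ _ A').
  apply: rt_step; split=> //; split.
    by move=> AA'; rewrite AA' A'H0 eqxx in dH0.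
  exists (A H0), (B H0); split; first by rewrite ltn_neqAle dH0 leAB.
  move=> H; rewrite ffunE; split; first by case: ifP => [/andP[/eqP-> _]|].
  rewrite subUset !sub1set => /andP[aH cH]; rewrite cH andbT.
  (* When [A H] is not [A H0], the flip leaves [H] alone, and [nca] prevents [A H] from being
     [B H0]. *)
  case: eqVneq => // nAH; split=> AH; first by rewrite AH eqxx in nAH.
  by case/negP: nca; rewrite -AH; apply: source_relI; rewrite // eq_sym.
apply: IHm => // [|H]; last by case: (A'E H) => ->.
apply: leq_trans lem; apply: proper_card; apply/properP; split.
  apply/subsetP => H; rewrite !inE.
  by case: (A'E H) => -> //; rewrite eqxx.
by exists H0; rewrite !inE // A'H0 eqxx.
Qed.

End Flips.

Theorem theorem1 (n : nat) (hn : 1 <= n) (HH : {set {set 'I_n}})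
    (hHH : hypergraph HH) (A B : hmap HH)
    (hA : acyclic_orientation A) (hB : acyclic_orientation B) :
  hypergraphic_le A B <-> (forall H : hyperedge HH, A H <= B H).
Proof.
split=> [leAB H|]; first exact: hypergraphic_le_pointwise.
exact: pointwise_hypergraphic_le.
Qed.
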